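(* Let $b=5$, $\gamma\in(1/5,1)$, $\psi(x)=-2\pi\sin(2\pi x)$, and assume $e(1)=2$. Then $\sigma(1)<5\gamma$.
   Context: $\mathcal{A}=\{0,\dots,b-1\}$. $S(x,\mathbf{i})=\sum_{n\ge1}\gamma^{n-1}\psi\big(\frac{x+i_1+i_2b+\cdots+i_nb^{n-1}}{b^n}\big)$ for $\mathbf{i}\in\mathcal{A}^{\mathbb{Z}^+}$, $S'=\partial_xS$. For $\mathbf{u}\in\mathcal{A}^q$, $x(\mathbf{u})=(x+u_1+\cdots+u_qb^{q-1})/b^q$. Sequences $\mathbf{i},\mathbf{j}$ are $(\varepsilon,\delta)$-tangent at $x_0$ if $|S(x_0,\mathbf{i})-S(x_0,\mathbf{j})|\le\varepsilon$ and $|S'(x_0,\mathbf{i})-S'(x_0,\mathbf{j})|\le\delta$. $E(q,x_0;\varepsilon,\delta)$: pairs $(\mathbf{k},\mathbf{l})\in\mathcal{A}^q\times\mathcal{A}^q$ such that some concatenations $\mathbf{ku},\mathbf{lv}$ are $(\varepsilon,\delta)$-tangent at $x_0$. For $J\subset\mathbb{R}$: $E(q,J)=\bigcap_{\varepsilon,\delta>0}\bigcup_{x\in J}E(q,x;\varepsilon,\delta)$, $e(q,J)=\max_{\mathbf{k}}\#\{\mathbf{l}:(\mathbf{k},\mathbf{l})\in E(q,J)\}$, and $e(q)=\lim_{p\to\infty}\max_{0\le k<b^p}e(q,[k/b^p,(k+1)/b^p])$. Weight function: measurable $\omega:[0,1)\to(0,\infty)$ with $\omega,1/\omega$ bounded.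 Admissible testing function of order $q$: measurable $V:[0,1)\times\mathcal{A}^q\times\mathcal{A}^q\to[0,\infty)$ such that for some $\varepsilon,\delta>0$, $V(x,\mathbf{u},\mathbf{v})V(x,\mathbf{v},\mathbf{u})\ge1$ whenever $x\in[0,1)$ and $(\mathbf{u},\mathbf{v})\in E(q,x;\varepsilon,\delta)$. $\Sigma_{V,\omega}(x)=\sup_{\mathbf{u}}\frac{\omega(x)}{\omega(x(\mathbf{u}))}\sum_{\mathbf{v}}V(x,\mathbf{u},\mathbf{v})$; $\sigma(q)=\inf_{\omega,V}\|\Sigma_{V,\omega}\|_\infty$. *)

(* Defs.v *)
From Stdlib Require Import Reals Lra Lia List ClassicalEpsilon.
Import ListNotations.
Open Scope R_scope.

(* outer_le A r  <->  m*(A) <= r : for every eps > 0, A is covered by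
   countably many open intervals (a n, c n) of total length <= r + eps. *)
Definition outer_le (A : R -> Prop) (r : R) : Prop :=
  forall eps, eps > 0 ->
    exists a c : nat -> R,
      (forall n, a n <= c n) /\
      (forall x, A x -> exists n, a n < x < c n) /\
      (forall N, sum_f_R0 (fun n => c n - a n) N <= r + eps).

Definition null_set (A : R -> Prop) : Prop := outer_le A 0.

(* Caratheodory criterion: m*(T) >= m*(T /\ E) + m*(T \ E) for every T. *)
Definition lebesgue_measurable (E : R -> Prop) : Prop :=
  forall (T : R -> Prop) (r : R), outer_le T r ->
    forall eps, eps > 0 ->
      exists r1 r2, outer_le (fun x => T x /\ E x) r1 /\
                    outer_le (fun x => T x /\ ~ E x) r2 /\
                    r1 + r2 <= r + eps.

Definition in01 (x : R) : Prop := 0 <= x < 1.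

Definition measurable01 (f : R -> R) : Prop :=
  forall a, lebesgue_measurable (fun x => in01 x /\ f x > a).

Definition ess_bound01 (f : R -> R) (M : R) : Prop :=
  null_set (fun x => in01 x /\ Rabs (f x) > M).

Definition is_glb (P : R -> Prop) (m : R) : Prop :=
  (forall y, P y -> m <= y) /\ (forall m', (forall y, P y -> m' <= y) -> m' <= m).

(* ||f||_oo = r  (only when f is essentially bounded) *)
Definition ess_norm_is (f : R -> R) (r : R) : Prop := is_glb (ess_bound01 f) r.

(* A^q as lists of length q over {0,...,b-1}; u_1 is the head. *)
Fixpoint words (b q : nat) : list (list nat) :=
  match q with
  | O => [[]]
  | S q' => flat_map (fun d => map (cons d) (words b q')) (seq 0 b)
  end.

Definition is_word (b q : nat) (k : list nat) : Prop :=
  length k = q /\ Forall (fun d => (d < b)%nat) k.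

(* A^{Z+}: i_1 = i 0, i_2 = i 1, ... *)
Definition is_seqA (b : nat) (i : nat -> nat) : Prop := forall n, (i n < b)%nat.

Definition concat_seq (k : list nat) (u : nat -> nat) : nat -> nat :=
  fun n => if Nat.ltb n (length k) then nth n k O else u (n - length k)%nat.

Fixpoint word_val (b : nat) (u : list nat) : R :=
  match u with
  | [] => 0
  | d :: u' => INR d + INR b * word_val b u'
  end.

Definition xw (b : nat) (x : R) (u : list nat) : R :=
  (x + word_val b u) / (INR b ^ length u).

Definition series_val (f : nat -> R) : R :=
  epsilon (inhabits 0) (fun l => infinite_sum f l).

(* S(x,i) = sum_{n>=1} gamma^(n-1) psi((x + i_1 + i_2 b + ... + i_n b^(n-1)) / b^n)
   (0-based summation index n-1) *)
Definition Sfun (b : nat) (gamma : R) (psi : R -> R) (x : R) (i : nat -> nat) : R :=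
  series_val (fun n =>
    gamma ^ n * psi ((x + sum_f_R0 (fun m => INR (i m) * INR b ^ m) n)
                     / INR b ^ (S n))).

Definition Sder (b : nat) (gamma : R) (psi : R -> R) (x : R) (i : nat -> nat) : R :=
  epsilon (inhabits 0)
    (fun l => derivable_pt_lim (fun y => Sfun b gamma psi y i) x l).

Definition tangent (b : nat) (gamma : R) (psi : R -> R)
    (eps delta x0 : R) (i j : nat -> nat) : Prop :=
  Rabs (Sfun b gamma psi x0 i - Sfun b gamma psi x0 j) <= eps /\
  Rabs (Sder b gamma psi x0 i - Sder b gamma psi x0 j) <= delta.

Definition Eloc (b : nat) (gamma : R) (psi : R -> R) (q : nat)
    (x0 eps delta : R) (k l : list nat) : Prop :=
  is_word b q k /\ is_word b q l /\
  exists u v, is_seqA b u /\ is_seqA b v /\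
    tangent b gamma psi eps delta x0 (concat_seq k u) (concat_seq l v).

Definition EJ (b : nat) (gamma : R) (psi : R -> R) (q : nat)
    (J : R -> Prop) (k l : list nat) : Prop :=
  forall eps delta, eps > 0 -> delta > 0 ->
    exists x, J x /\ Eloc b gamma psi q x eps delta k l.

Definition count_words (b q : nat) (P : list nat -> Prop) : nat :=
  fold_right (fun l acc =>
      ((if excluded_middle_informative (P l) then 1 else 0) + acc)%nat)
    O (words b q).

Definition list_max (s : list nat) : nat := fold_right Nat.max O s.

Definition eJ (b : nat) (gamma : R) (psi : R -> R) (q : nat) (J : R -> Prop) : nat :=
  list_max (map (fun k => count_words b q (fun l => EJ b gamma psi q J k l))
                (words b q)).

Definition badic (b p k : nat) : R -> Prop :=
  fun x => INR k / INR b ^ p <= x <= (INR k + 1) / INR b ^ p.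

Definition e_level (b : nat) (gamma : R) (psi : R -> R) (q p : nat) : nat :=
  list_max (map (fun k => eJ b gamma psi q (badic b p k)) (seq 0 (b ^ p))).

Definition e_is (b : nat) (gamma : R) (psi : R -> R) (q n : nat) : Prop :=
  Un_cv (fun p => INR (e_level b gamma psi q p)) (INR n).

Definition weight (omega : R -> R) : Prop :=
  measurable01 omega /\
  (forall x, in01 x -> omega x > 0) /\
  (exists M, forall x, in01 x -> omega x <= M) /\
  (exists M, forall x, in01 x -> / omega x <= M).

Definition admissible (b : nat) (gamma : R) (psi : R -> R) (q : nat)
    (V : R -> list nat -> list nat -> R) : Prop :=
  (forall u v, is_word b q u -> is_word b q v -> measurable01 (fun x => V x u v)) /\
  (forall x u v, in01 x -> is_word b q u -> is_word b q v -> 0 <= V x u v) /\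
  exists eps delta, eps > 0 /\ delta > 0 /\
    forall x u v, in01 x ->
      Eloc b gamma psi q x eps delta u v -> V x u v * V x v u >= 1.

Definition list_sumR (s : list R) : R := fold_right Rplus 0 s.
Definition list_maxR (s : list R) : R := fold_right Rmax 0 s.

(* Sigma_{V,omega}(x) = max_u omega(x)/omega(x(u)) * sum_v V(x,u,v)
   (all terms are >= 0, so the 0 seed of the max is harmless) *)
Definition Sigma (b q : nat) (V : R -> list nat -> list nat -> R) (omega : R -> R)
    (x : R) : R :=
  list_maxR (map (fun u =>
      omega x / omega (xw b x u) *
      list_sumR (map (fun v => V x u v) (words b q)))
    (words b q)).

Definition sigma_vals (b : nat) (gamma : R) (psi : R -> R) (q : nat) (r : R) : Prop :=
  exists omega V, weight omega /\ admissible b gamma psi q V /\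
    ess_norm_is (Sigma b q V omega) r.

Definition sigma_q (b : nat) (gamma : R) (psi : R -> R) (q : nat) : R :=
  epsilon (inhabits 0) (fun s => is_glb (sigma_vals b gamma psi q) s).

Definition psi0 (x : R) : R := - (2 * PI) * sin (2 * PI * x).

(* Main.v *)
(** Distinct digits [k], [l] can be tangent at [x] only if the second and later
    terms of [S] and [S'] compensate the difference of the leading ones.  In the
    plane (sine, cosine) the leading half-difference is a chord of half-length
    [|sin (PI (k - l) / 5)|], the second one has length at most [gamma], and the
    rest is a geometric tail.  For [gamma <= 7/20] no pair is tangent, so
    [sigma 1 <= 1].  For [gamma <= 2/5] the only tangent pairs are (1,2) for [x]
    near 1, (2,3) for [x] near 0 and (0,4) for [x] near 1/2, and with the radius
    1/12 the images [(x + k) / 5] of such an [x] avoid the union [B] of these three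
    neighbourhoods.  Hence the weight equal to 1 on [B] and 3/2 elsewhere gives
    [sigma 1 <= 3/2 < 5 gamma].  For [gamma > 2/5], compactness and [e 1 = 2] give
    [sigma 1 <= 2 < 5 gamma]. *)

From Stdlib Require Import Reals Lra Lia List ClassicalEpsilon.
From Stdlib Require Import FunctionalExtensionality.
From Coquelicot Require Import Coquelicot.
Require Import Defs.
Import ListNotations.
Open Scope R_scope.

(** * Outer measure and measurable sets *)

Lemma outer_le_subset (A B : R -> Prop) (r : R) :
  (forall x, A x -> B x) -> outer_le B r -> outer_le A r.
Proof.
  intros HAB HB eps He.
  destruct (HB eps He) as (a & c & H1 & H2 & H3).
  exists a, c; repeat split; auto.
Qed.

(** The two covers are interleaved, one on the even indices and the other on the odd ones. A partial
    sum up to [N] is at most the one up to [2 * N + 1], which splits into a partial sum of each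
    cover. *)
Lemma outer_le_union (A B : R -> Prop) (r s : R) :
  outer_le A r -> outer_le B s -> outer_le (fun x => A x \/ B x) (r + s).
Proof.
  intros HA HB eps He.
  destruct (HA (eps / 2) ltac:(lra)) as (a1 & c1 & Ha1 & Hc1 & Hs1).
  destruct (HB (eps / 2) ltac:(lra)) as (a2 & c2 & Ha2 & Hc2 & Hs2).
  set (mix := fun (f g : nat -> R) n =>
    if Nat.even n then f (Nat.div2 n) else g (Nat.div2 n)).
  assert (Heven : forall f g n, mix f g (2 * n)%nat = f n).
  { intros f g n; unfold mix; rewrite Nat.even_even, Nat.div2_double; reflexivity. }
  assert (Hodd : forall f g n, mix f g (S (2 * n)) = g n).
  { intros f g n; unfold mix.
    rewrite Nat.even_succ, Nat.odd_even, Nat.div2_succ_double; reflexivity. }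
  assert (Hmix : forall n, mix a1 a2 n <= mix c1 c2 n).
  { intro n; unfold mix; destruct (Nat.even n); auto. }
  exists (mix a1 a2), (mix c1 c2); split; [exact Hmix | split].
  - intros x [Hx | Hx].
    + destruct (Hc1 x Hx) as [n Hn]; exists (2 * n)%nat; now rewrite !Heven.
    + destruct (Hc2 x Hx) as [n Hn]; exists (S (2 * n)); now rewrite !Hodd.
  - intro N.
    set (d := fun n => mix c1 c2 n - mix a1 a2 n).
    assert (Hsum : forall n, sum_f_R0 d (S (2 * n)) =
      sum_f_R0 (fun n => c1 n - a1 n) n + sum_f_R0 (fun n => c2 n - a2 n) n).
    { induction n as [|n IH].
      - unfold d; simpl sum_f_R0.
        change 1%nat with (S (2 * 0)); rewrite !Hodd.
        change 0%nat with (2 * 0)%nat at 1 2; rewrite !Heven; lra.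
      - replace (S (2 * S n)) with (S (S (S (2 * n)))) by lia.
        rewrite tech5, tech5, IH, !tech5; unfold d.
        replace (S (S (2 * n))) with (2 * S n)%nat by lia.
        rewrite !Heven, !Hodd; lra. }
    assert (Hmono : sum_f_R0 d N <= sum_f_R0 d (S (2 * N))).
    { assert (H : forall k, sum_f_R0 d N <= sum_f_R0 d (N + k)).
      { induction k as [|k IH]; [rewrite Nat.add_0_r; lra|].
        rewrite Nat.add_succ_r, tech5.
        assert (0 <= d (S (N + k))) by (unfold d; specialize (Hmix (S (N + k))); lra).
        lra. }
      replace (S (2 * N)) with (N + S N)%nat by lia; apply H. }
    fold d; rewrite Hsum in Hmono.
    specialize (Hs1 N); specialize (Hs2 N); lra.
Qed.

Lemma lebesgue_measurable_ext (E F : R -> Prop) :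
  (forall x, E x <-> F x) -> lebesgue_measurable E -> lebesgue_measurable F.
Proof.
  intros HEF HE T r HT eps He.
  destruct (HE T r HT eps He) as (r1 & r2 & H1 & H2 & H3).
  exists r1, r2; repeat split; auto.
  - revert H1; apply outer_le_subset; intros x; rewrite HEF; tauto.
  - revert H2; apply outer_le_subset; intros x; rewrite HEF; tauto.
Qed.

Lemma lebesgue_measurable_compl (E : R -> Prop) :
  lebesgue_measurable E -> lebesgue_measurable (fun x => ~ E x).
Proof.
  intros HE T r HT eps He.
  destruct (HE T r HT eps He) as (r1 & r2 & H1 & H2 & H3).
  exists r2, r1; repeat split; [exact H2 | | lra].
  revert H1; apply outer_le_subset; intros x [Hx Hn]; split; [exact Hx|tauto].
Qed.

(** [T] is cut by [E], and then only the piece inside [E] is cut by [F]; what lies outside [E] or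
    outside [F] is reassembled by subadditivity. *)
Lemma lebesgue_measurable_inter (E F : R -> Prop) :
  lebesgue_measurable E -> lebesgue_measurable F ->
  lebesgue_measurable (fun x => E x /\ F x).
Proof.
  intros HE HF T r HT eps He.
  destruct (HE T r HT (eps / 2) ltac:(lra)) as (r1 & r2 & H1 & H2 & H3).
  destruct (HF _ r1 H1 (eps / 2) ltac:(lra)) as (s1 & s2 & G1 & G2 & G3).
  exists s1, (s2 + r2); repeat split; [ | | lra].
  - revert G1; apply outer_le_subset; tauto.
  - generalize (outer_le_union _ _ _ _ G2 H2); apply outer_le_subset.
    intros x; tauto.
Qed.

Lemma lebesgue_measurable_union (E F : R -> Prop) :
  lebesgue_measurable E -> lebesgue_measurable F ->
  lebesgue_measurable (fun x => E x \/ F x).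
Proof.
  intros HE HF.
  apply lebesgue_measurable_ext with (fun x => ~ (~ E x /\ ~ F x)).
  - intros x; tauto.
  - apply lebesgue_measurable_compl, lebesgue_measurable_inter;
      apply lebesgue_measurable_compl; assumption.
Qed.

Lemma null_set_singleton (c : R) : null_set (fun x => x = c).
Proof.
  intros eps He.
  (* All the length sits in the interval of index 0; the others are degenerate. *)
  set (e := fun n : nat => if Nat.eqb n 0 then eps / 2 else 0).
  assert (He0 : forall n, 0 <= e n) by (intros [|n]; unfold e; simpl; lra).
  exists (fun n => c - e n), (fun n => c + e n); split; [|split].
  - intro n; specialize (He0 n); lra.
  - intros x ->; exists 0%nat; unfold e; simpl; lra.
  - intro N; assert (H : sum_f_R0 (fun n => c + e n - (c - e n)) N = eps).
    { induction N as [|N IH]; [|rewrite tech5, IH]; unfold e; simpl; lra. }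
    rewrite H; lra.
Qed.

Lemma lebesgue_measurable_const (P : Prop) : lebesgue_measurable (fun _ => P).
Proof.
  assert (Hempty : outer_le (fun _ => False) 0).
  { apply outer_le_subset with (fun x => x = 0); [tauto | apply null_set_singleton]. }
  intros T r HT eps He; destruct (classic P) as [HP | HP].
  - exists r, 0; repeat split; [| |lra].
    + revert HT; apply outer_le_subset; tauto.
    + revert Hempty; apply outer_le_subset; tauto.
  - exists 0, r; repeat split; [| |lra].
    + revert Hempty; apply outer_le_subset; tauto.
    + revert HT; apply outer_le_subset; tauto.
Qed.

Lemma lebesgue_measurable_finite_union (N : nat) (E : nat -> R -> Prop) :
  (forall k, lebesgue_measurable (E k)) ->
  lebesgue_measurable (fun x => exists k, (k < N)%nat /\ E k x).
Proof.
  intros HE; induction N as [|N IH].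
  - apply lebesgue_measurable_ext with (fun _ => False);
      [|apply lebesgue_measurable_const].
    intros x; split; [tauto | intros (k & Hk & _); lia].
  - apply lebesgue_measurable_ext with (fun x => (exists k, (k < N)%nat /\ E k x) \/ E N x).
    + intros x; split.
      * intros [(k & Hk & Hx) | Hx]; [exists k | exists N]; split; auto with arith.
      * intros (k & Hk & Hx); destruct (Nat.eq_dec k N) as [-> | Hne]; [now right|].
        left; exists k; split; [lia | assumption].
    + now apply lebesgue_measurable_union.
Qed.

(* Every interval of a cover of [T] is cut at [c]; the point [c] itself, which
   the two families of open pieces miss, is a null set. *)
Lemma lebesgue_measurable_lt (c : R) : lebesgue_measurable (fun x => x < c).
Proof.
  intros T r HT eps He.
  destruct (HT eps He) as (a & b & Hab & Hcov & Hsum).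
  set (u := sum_f_R0 (fun n => Rmin (b n) c - Rmin (a n) c)).
  set (v := sum_f_R0 (fun n => Rmax (b n) c - Rmax (a n) c)).
  assert (Hu : Un_growing u).
  { intro n; unfold u; rewrite tech5; specialize (Hab (S n)).
    assert (Rmin (a (S n)) c <= Rmin (b (S n)) c) by (apply Rle_min_compat_r; lra).
    lra. }
  assert (Hv : Un_growing v).
  { intro n; unfold v; rewrite tech5; specialize (Hab (S n)).
    assert (Rmax (a (S n)) c <= Rmax (b (S n)) c) by (apply Rle_max_compat_r; lra).
    lra. }
  (* The minimum and the maximum of an endpoint and [c] add up to the endpoint plus [c], so cutting
     at [c] preserves lengths. *)
  assert (Huv : forall n, u n + v n <= r + eps).
  { intro n; unfold u, v; rewrite <- sum_plus.
    eapply Rle_trans; [|apply (Hsum n)]; apply sum_Rle; intros k _.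
    unfold Rmin, Rmax; destruct (Rle_dec (b k) c), (Rle_dec (a k) c); lra. }
  assert (Hpos : forall w, Un_growing w -> w 0%nat >= 0 -> forall n, 0 <= w n).
  { intros w Hw H0; induction n as [|n IH]; [lra|]; specialize (Hw n); lra. }
  assert (Hu0 : forall n, 0 <= u n).
  { apply Hpos; [assumption|]; unfold u; simpl.
    assert (Rmin (a 0%nat) c <= Rmin (b 0%nat) c) by (apply Rle_min_compat_r, Hab); lra. }
  assert (Hv0 : forall n, 0 <= v n).
  { apply Hpos; [assumption|]; unfold v; simpl.
    assert (Rmax (a 0%nat) c <= Rmax (b 0%nat) c) by (apply Rle_max_compat_r, Hab); lra. }
  destruct (growing_cv u Hu) as [l1 Hl1].
  { exists (r + eps); intros y [n ->]; specialize (Huv n); specialize (Hv0 n); lra. }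
  destruct (growing_cv v Hv) as [l2 Hl2].
  { exists (r + eps); intros y [n ->]; specialize (Huv n); specialize (Hu0 n); lra. }
  exists l1, l2; split; [|split].
  - intros e Hepos; exists (fun n => Rmin (a n) c), (fun n => Rmin (b n) c).
    split; [intro n; apply Rle_min_compat_r, Hab|split].
    + intros x [Hx Hxc]; destruct (Hcov x Hx) as [n Hn]; exists n; split.
      * eapply Rle_lt_trans; [apply Rmin_l | lra].
      * apply Rmin_glb_lt; lra.
    + intro N; generalize (growing_ineq u l1 Hu Hl1 N); unfold u; lra.
  - apply outer_le_subset with (fun x => (T x /\ c < x) \/ x = c).
    { intros x [Hx Hxc]; destruct (Req_dec x c); [tauto | left; split; [tauto | lra]]. }
    replace l2 with (l2 + 0) by lra.
    apply outer_le_union; [|apply null_set_singleton].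
    intros e Hepos; exists (fun n => Rmax (a n) c), (fun n => Rmax (b n) c).
    split; [intro n; apply Rle_max_compat_r, Hab|split].
    + intros x [Hx Hxc]; destruct (Hcov x Hx) as [n Hn]; exists n; split.
      * apply Rmax_lub_lt; lra.
      * eapply Rlt_le_trans; [|apply Rmax_l]; lra.
    + intro N; generalize (growing_ineq v l2 Hv Hl2 N); unfold v; lra.
  - apply Rle_cv_lim with (fun n => u n + v n) (fun _ => r + eps); [exact Huv | |].
    + now apply CV_plus.
    + intros e Hepos; exists 0%nat; intros; unfold Rdist; rewrite Rminus_diag, Rabs_R0; lra.
Qed.

Lemma lebesgue_measurable_Ico (p q : R) : lebesgue_measurable (fun x => p <= x < q).
Proof.
  apply lebesgue_measurable_ext with (fun x => ~ x < p /\ x < q); [intro x; lra|].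
  apply lebesgue_measurable_inter;
    [apply lebesgue_measurable_compl|]; apply lebesgue_measurable_lt.
Qed.

Lemma measurable01_two_valued (P : R -> Prop) (c1 c2 : R) :
  lebesgue_measurable P ->
  measurable01 (fun x => if excluded_middle_informative (P x) then c1 else c2).
Proof.
  intros HP a.
  apply lebesgue_measurable_ext with
    (fun x => in01 x /\ ((c1 > a /\ P x) \/ (c2 > a /\ ~ P x))).
  - intro x; destruct (excluded_middle_informative (P x)); tauto.
  - apply lebesgue_measurable_inter; [apply lebesgue_measurable_Ico|].
    apply lebesgue_measurable_union; apply lebesgue_measurable_inter;
      try apply lebesgue_measurable_const; [|apply lebesgue_measurable_compl]; assumption.
Qed.

(* Real induction on [x]: finitely many of the covering intervals have total
   length at least [x] to the left of [x]. *)
Lemma in01_not_null : ~ null_set in01.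
Proof.
  (* The induction below reaches 1/2, more than the total length 1/4 granted here. *)
  intro H; destruct (H (1 / 4) ltac:(lra)) as (a & c & Hac & Hcov & Hsum).
  set (L := fun x n => Rmax 0 (Rmin (c n) x - a n)).
  assert (HL0 : forall x n, 0 <= L x n) by (intros; apply Rmax_l).
  assert (HLmono : forall x y n, x <= y -> L x n <= L y n).
  { intros x y n Hxy; unfold L; apply Rle_max_compat_l.
    assert (Rmin (c n) x <= Rmin (c n) y) by (apply Rle_min_compat_l; lra); lra. }
  set (G := fun x => 0 <= x <= 1 / 2 /\ exists N, x <= sum_f_R0 (L x) N).
  assert (HGbound : bound G) by (exists (1 / 2); intros x [Hx _]; lra).
  assert (HG0 : G 0).
  { split; [lra|]; exists 0%nat; apply HL0. }
  destruct (completeness G HGbound (ex_intro _ 0 HG0)) as [z [Hz1 Hz2]].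
  assert (Hz01 : 0 <= z <= 1 / 2).
  { split; [now apply Hz1|]; apply Hz2; intros x [Hx _]; lra. }
  destruct (Hcov z ltac:(unfold in01; lra)) as [m Hm].
  assert (Hx : exists x, G x /\ a m < x <= z).
  { apply NNPP; intro Hn; assert (z <= a m); [|lra].
    apply Hz2; intros x Gx; apply Rnot_lt_le; intro Hlt.
    apply Hn; exists x; repeat split; [apply Gx.. | lra | now apply Hz1]. }
  destruct Hx as (x & [Hx1 [N HN]] & Hx2).
  (* A point past the supremum [z], still inside the interval around [z], unless [z] is already
     1/2. *)
  set (y := Rmin (1 / 2) ((z + c m) / 2)).
  assert (Hy : x <= y /\ y <= 1 / 2 /\ y < c m /\ (y <= z -> z = 1 / 2)).
  { unfold y, Rmin; destruct (Rle_dec (1 / 2) ((z + c m) / 2)); lra. }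
  (* From [x] to [y] the interval [m] gains [y - x] and no other one loses; the sum is prolonged to
     [N + m] so that [m] is surely counted. *)
  assert (Hinc : forall f g : nat -> R, (forall n, f n <= g n) -> (forall n, 0 <= f n) ->
    f m + (y - x) <= g m -> exists N', sum_f_R0 f N + (y - x) <= sum_f_R0 g N').
  { intros f g Hfg Hf Hfgm; exists (N + m)%nat.
    assert (Hlong : forall k, sum_f_R0 f N <= sum_f_R0 f (N + k)).
    { induction k as [|k IH]; [rewrite Nat.add_0_r; lra|].
      rewrite Nat.add_succ_r, tech5; specialize (Hf (S (N + k))); lra. }
    assert (Hgap : forall k, (m <= k)%nat -> sum_f_R0 f k + (y - x) <= sum_f_R0 g k).
    { induction k as [|k IH]; intro Hk.
      - assert (m = 0)%nat by lia; subst m; exact Hfgm.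
      - rewrite !tech5; destruct (Nat.eq_dec m (S k)) as [<- | Hne].
        + assert (sum_f_R0 f k <= sum_f_R0 g k) by (apply sum_Rle; auto); lra.
        + specialize (IH ltac:(lia)); specialize (Hfg (S k)); lra. }
    specialize (Hlong m); specialize (Hgap (N + m)%nat ltac:(lia)); lra. }
  destruct (Hinc (L x) (L y)) as [N' HN'].
  - intro n; apply HLmono; lra.
  - apply HL0.
  - unfold L; rewrite !Rmin_right by lra; rewrite !Rmax_right by lra; lra.
  - assert (HGy : G y) by (split; [lra | exists N'; lra]).
    assert (z = 1 / 2) by (apply Hy, Hz1, HGy).
    assert (y = 1 / 2) by (specialize (Hz1 y HGy); unfold y, Rmin in *;
      destruct (Rle_dec (1 / 2) ((z + c m) / 2)); lra).
    assert (sum_f_R0 (L y) N' <= sum_f_R0 (fun n => c n - a n) N').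
    { apply sum_Rle; intros n _; unfold L; specialize (Hac n).
      apply Rmax_lub; [lra|]; generalize (Rmin_l (c n) y); lra. }
    specialize (Hsum N'); lra.
Qed.

(** * Upper bounds for [sigma] *)

Lemma glb_exists (P : R -> Prop) (m : R) :
  (exists y, P y) -> (forall y, P y -> m <= y) -> exists s, is_glb P s.
Proof.
  intros [y0 Hy0] Hm.
  destruct (completeness (fun y => P (- y))) as [s [Hs1 Hs2]].
  - exists (- m); intros y Hy; specialize (Hm _ Hy); lra.
  - exists (- y0); now rewrite Ropp_involutive.
  - exists (- s); split.
    + intros y Hy; assert (- y <= s) by (apply Hs1; now rewrite Ropp_involutive); lra.
    + intros m' Hm'; assert (s <= - m'); [|lra].
      apply Hs2; intros y Hy; specialize (Hm' _ Hy); lra.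
Qed.

(** A negative [M] would make all of [0,1) exceptional, hence null. This keeps essential norms, and
    with them the values whose infimum is [sigma_q], bounded below. *)
Lemma ess_bound01_ge0 (f : R -> R) (M : R) : ess_bound01 f M -> 0 <= M.
Proof.
  intros H; apply Rnot_lt_le; intro HM; apply in01_not_null.
  revert H; apply outer_le_subset; intros x Hx; split; [assumption|].
  generalize (Rabs_pos (f x)); lra.
Qed.

Lemma ess_norm_exists_le (f : R -> R) (M : R) :
  (forall x, in01 x -> Rabs (f x) <= M) -> exists r, ess_norm_is f r /\ r <= M.
Proof.
  intros Hf.
  assert (HM : ess_bound01 f M).
  { apply outer_le_subset with (fun x => x = 0); [|apply null_set_singleton].
    intros x [Hx Hgt]; specialize (Hf x Hx); lra. }
  destruct (glb_exists (ess_bound01 f) 0) as [r Hr].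
  - now exists M.
  - apply ess_bound01_ge0.
  - exists r; split; [exact Hr | now apply Hr].
Qed.

(** The choice in [sigma_q] is meaningful only if an infimum exists: [r] makes the set of values
    nonempty, and 0 bounds it below. *)
Lemma sigma_q_le_val (b : nat) (gamma : R) (psi : R -> R) (q : nat) (r : R) :
  sigma_vals b gamma psi q r -> sigma_q b gamma psi q <= r.
Proof.
  intros Hr; unfold sigma_q.
  assert (Hex : exists s, is_glb (sigma_vals b gamma psi q) s).
  { apply glb_exists with 0; [now exists r|].
    intros y (omega & V & _ & _ & Hy); apply Hy; apply ess_bound01_ge0. }
  now apply (epsilon_spec (inhabits 0)) in Hex; apply Hex.
Qed.

Lemma in_words_is_word (b q : nat) (u : list nat) : In u (words b q) -> is_word b q u.
Proof.
  revert u; induction q as [|q IH]; intros u; simpl.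
  - intros [<- | []]; split; auto.
  - intros H; apply in_flat_map in H as (d & Hd & Hu).
    apply in_map_iff in Hu as (u' & <- & Hu').
    destruct (IH _ Hu') as [Hl Hf]; apply in_seq in Hd.
    split; [simpl; congruence | constructor; [lia | assumption]].
Qed.

Lemma word_val_bounds (b : nat) (u : list nat) :
  List.Forall (fun d => (d < b)%nat) u -> 0 <= word_val b u <= INR b ^ length u - 1.
Proof.
  induction 1 as [|d u Hd _ IH]; simpl; [lra|].
  assert (Hd' : INR d + 1 <= INR b) by (rewrite <- S_INR; apply le_INR; lia).
  generalize (pos_INR d) (pos_INR b); intros; split.
  - apply Rplus_le_le_0_compat; [lra | apply Rmult_le_pos; lra].
  - assert (INR b * word_val b u <= INR b * (INR b ^ length u - 1))
      by (apply Rmult_le_compat_l; lra).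
    lra.
Qed.

Lemma xw_in01 (b : nat) (x : R) (u : list nat) :
  List.Forall (fun d => (d < b)%nat) u -> in01 x -> in01 (xw b x u).
Proof.
  intros Hu [Hx0 Hx1]; destruct (word_val_bounds b u Hu) as [H0 H1].
  assert (Hpos : 0 < INR b ^ length u) by lra.
  unfold in01, xw; split.
  - apply Rle_mult_inv_pos; lra.
  - apply Rlt_div_l; lra.
Qed.

Lemma list_maxR_le (s : list R) (M : R) :
  0 <= M -> (forall y, In y s -> y <= M) -> list_maxR s <= M.
Proof.
  intros HM; induction s as [|y s IH]; simpl; intros H; [assumption|].
  apply Rmax_lub; auto.
Qed.

Lemma list_maxR_ge0 (s : list R) : 0 <= list_maxR s.
Proof.
  induction s as [|y s IH]; simpl; [lra|].
  eapply Rle_trans; [exact IH | apply Rmax_r].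
Qed.

Definition indicator (P : Prop) : R := if excluded_middle_informative P then 1 else 0.

Lemma Eloc_sym (b : nat) (gamma : R) (psi : R -> R) (q : nat) (x eps delta : R) (k l : list nat) :
  Eloc b gamma psi q x eps delta k l -> Eloc b gamma psi q x eps delta l k.
Proof.
  intros (Hk & Hl & u & v & Hu & Hv & H1 & H2); repeat split; try apply Hk; try apply Hl.
  exists v, u; repeat split; auto; rewrite Rabs_minus_sym; assumption.
Qed.

(* The testing function used is the indicator of a relation [Q] containing
   every sufficiently tangent pair. *)
Lemma sigma_q_le_of_relation (b : nat) (gamma : R) (psi : R -> R) (q : nat)
    (omega : R -> R) (Q : R -> list nat -> list nat -> Prop) (M : R) :
  weight omega ->
  (forall u v, lebesgue_measurable (fun x => Q x u v)) ->
  (exists eps delta, eps > 0 /\ delta > 0 /\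
    forall x u v, in01 x -> Eloc b gamma psi q x eps delta u v -> Q x u v) ->
  0 <= M ->
  (forall x u, in01 x -> is_word b q u ->
    omega x * list_sumR (map (fun v => indicator (Q x u v)) (words b q))
      <= M * omega (xw b x u)) ->
  sigma_q b gamma psi q <= M.
Proof.
  intros Hw Hmeas (eps & delta & Heps & Hdelta & HQ) HM Hsum.
  set (V := fun x u v => indicator (Q x u v)).
  destruct (ess_norm_exists_le (Sigma b q V omega) M) as [r [Hr HrM]].
  { intros x Hx; unfold Sigma; rewrite Rabs_right by apply Rle_ge, list_maxR_ge0.
    apply list_maxR_le; [assumption|].
    intros y Hy; apply in_map_iff in Hy as (u & <- & Hu); apply in_words_is_word in Hu.
    assert (Hpos : omega (xw b x u) > 0).
    { apply Hw, xw_in01; [apply Hu | assumption]. }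
    unfold Rdiv; rewrite Rmult_assoc, (Rmult_comm (/ _)), <- Rmult_assoc.
    apply Rle_div_l; [assumption|]; now apply Hsum. }
  apply Rle_trans with r; [|assumption]; apply sigma_q_le_val.
  exists omega, V; split; [assumption | split; [|assumption]].
  split; [|split].
  - intros u v _ _; apply measurable01_two_valued, Hmeas.
  - intros x u v _ _ _; unfold V, indicator.
    destruct (excluded_middle_informative (Q x u v)); lra.
  (* Tangency is symmetric, so on a tangent pair both factors of the product are 1. *)
  - exists eps, delta; repeat split; try assumption.
    intros x u v Hx HE; unfold V, indicator.
    destruct (excluded_middle_informative (Q x u v)) as [_ | []]; [|now apply HQ].
    destruct (excluded_middle_informative (Q x v u)) as [_ | []]; [lra|].
    now apply HQ, Eloc_sym.
Qed.

Lemma weight_two_valued (B : R -> Prop) (c1 c2 : R) :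
  0 < c1 -> 0 < c2 -> lebesgue_measurable B ->
  weight (fun x => if excluded_middle_informative (B x) then c1 else c2).
Proof.
  intros H1 H2 HB; split; [now apply measurable01_two_valued | split; [|split]].
  - intros x _; destruct (excluded_middle_informative (B x)); lra.
  - exists (Rmax c1 c2); intros x _.
    destruct (excluded_middle_informative (B x)); [apply Rmax_l | apply Rmax_r].
  - exists (Rmax (/ c1) (/ c2)); intros x _.
    destruct (excluded_middle_informative (B x)); [apply Rmax_l | apply Rmax_r].
Qed.

(** * Counting tangent pairs *)

Lemma Eloc_mono (b : nat) (gamma : R) (psi : R -> R) (q : nat)
    (x e d e' d' : R) (k l : list nat) :
  e <= e' -> d <= d' -> Eloc b gamma psi q x e d k l -> Eloc b gamma psi q x e' d' k l.
Proof.
  intros He Hd (Hk & Hl & u & v & Hu & Hv & H1 & H2); split; [|split]; [assumption..|].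
  exists u, v; repeat split; auto; lra.
Qed.

(** The least of finitely many thresholds. It replaces the intersection over all [eps] and [delta]
    in [EJ] by a single tolerance. *)
Lemma uniform_threshold {A : Type} (s : list A) (P : A -> R -> Prop) :
  (forall a e e', e <= e' -> P a e' -> P a e) ->
  (forall a, In a s -> exists e, e > 0 /\ P a e) ->
  exists e, e > 0 /\ forall a, In a s -> P a e.
Proof.
  intros Hmono; induction s as [|a s IH]; intros H.
  - exists 1; split; [lra | intros a []].
  - destruct IH as (e & He & Hs); [intros; apply H; now right|].
    destruct (H a (or_introl eq_refl)) as (e' & He' & Ha).
    exists (Rmin e e'); split; [apply Rmin_glb_lt; lra|].
    intros a' [<- | Hin].
    + eapply Hmono; [apply Rmin_r | assumption].
    + eapply Hmono; [apply Rmin_l | now apply Hs].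
Qed.

Lemma is_word_in_words (b q : nat) (u : list nat) : is_word b q u -> In u (words b q).
Proof.
  revert u; induction q as [|q IH]; intros u [Hl Hf].
  - destruct u; [now left | discriminate].
  - destruct u as [|d u]; [discriminate|]; inversion Hf; subst.
    simpl; apply in_flat_map; exists d; split; [apply in_seq; lia|].
    apply in_map, IH; split; [now injection Hl | assumption].
Qed.

Lemma in_le_list_max (s : list nat) (n : nat) : In n s -> (n <= list_max s)%nat.
Proof.
  induction s as [|m s IH]; simpl; [tauto|].
  intros [-> | H]; [lia | specialize (IH H); lia].
Qed.

(** The right-hand side is [count_words] unfolded, over an arbitrary list so that induction
    applies. *)
Lemma list_sum_indicator_le (ws : list (list nat)) (Q P : list nat -> Prop) :
  (forall v, Q v -> P v) ->
  list_sumR (map (fun v => indicator (Q v)) ws) <=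
  INR (fold_right (fun l acc =>
    ((if excluded_middle_informative (P l) then 1 else 0) + acc)%nat) O ws).
Proof.
  intros HQP; induction ws as [|w ws IH]; simpl fold_right; simpl list_sumR; [simpl; lra|].
  rewrite plus_INR; apply Rplus_le_compat; [|exact IH].
  unfold indicator; destruct (excluded_middle_informative (Q w)),
    (excluded_middle_informative (P w)); simpl; try lra.
  exfalso; auto.
Qed.

(** The weight is constant, and on each cell of level [p] the relation is [EJ] of that cell, so each
    row sum is at most [eJ]. A pair outside [EJ] already fails at some positive tolerance, and there
    are finitely many cells and pairs. *)
Lemma sigma_q_le_e_level (b : nat) (gamma : R) (psi : R -> R) (q p : nat) :
  (1 <= b)%nat -> sigma_q b gamma psi q <= INR (e_level b gamma psi q p).
Proof.
  intros Hb.
  assert (Hbp : 0 < INR b ^ p) by (apply pow_lt, lt_0_INR; lia).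
  (* Half-open, unlike [badic], so that each point of [0,1) lies in exactly one cell. *)
  set (cell := fun k x => INR k / INR b ^ p <= x < (INR k + 1) / INR b ^ p).
  assert (Hcell : forall x, in01 x -> exists k, (k < b ^ p)%nat /\ cell k x).
  { intros x [Hx0 Hx1].
    destruct (nfloor_ex (x * INR b ^ p)) as [k Hk]; [apply Rmult_le_pos; lra|].
    exists k; split.
    - apply INR_lt; rewrite pow_INR; nra.
    - unfold cell; split; [apply Rle_div_l; lra | apply Rlt_div_r; lra]. }
  assert (Huniq : forall x k k', cell k x -> cell k' x -> k = k').
  { intros x k k' [H1 H2] [H3 H4].
    apply Rle_div_l in H1, H3; try lra; apply Rlt_div_r in H2, H4; try lra.
    assert (k < S k')%nat by (apply INR_lt; rewrite S_INR; lra).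
    assert (k' < S k)%nat by (apply INR_lt; rewrite S_INR; lra).
    lia. }
  set (Q := fun x u v => exists k, (k < b ^ p)%nat /\
    (cell k x /\ EJ b gamma psi q (badic b p k) u v)).
  apply (sigma_q_le_of_relation b gamma psi q
    (fun x => if excluded_middle_informative True then 1 else 1) Q).
  - apply weight_two_valued; [lra | lra | apply lebesgue_measurable_const].
  - intros u v; apply lebesgue_measurable_finite_union; intro k.
    apply lebesgue_measurable_inter; [apply lebesgue_measurable_Ico|].
    apply lebesgue_measurable_const.
  (* [P] says that [e]-tangency somewhere in the closed cell already forces membership in [EJ]. *)
  - set (P := fun t e => let '(k, (u, v)) := t in
      (exists x, badic b p k x /\ Eloc b gamma psi q x e e u v) ->
      EJ b gamma psi q (badic b p k) u v).
    destruct (uniform_threshold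
      (list_prod (seq 0 (b ^ p)) (list_prod (words b q) (words b q))) P)
      as (e & He & HP).
    + intros [k [u v]] e e' Hee' H (x & Hx & HE); apply H.
      exists x; split; [assumption|]; revert HE; now apply Eloc_mono.
    + intros [k [u v]] _; unfold P.
      destruct (classic (EJ b gamma psi q (badic b p k) u v)) as [HE | HE].
      { exists 1; split; [lra | tauto]. }
      apply not_all_ex_not in HE as [e HE]; apply not_all_ex_not in HE as [d HE].
      apply imply_to_and in HE as [He HE]; apply imply_to_and in HE as [Hd HE].
      exists (Rmin e d); split; [apply Rmin_glb_lt; lra|].
      intros (x & Hx & Hloc); exfalso; apply HE; exists x; split; [assumption|].
      revert Hloc; apply Eloc_mono; [apply Rmin_l | apply Rmin_r].
    + exists e, e; repeat split; try assumption.
      intros x u v Hx HE; destruct (Hcell x Hx) as (k & Hk & Hc).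
      exists k; repeat split; try apply Hc; try assumption.
      apply (HP (k, (u, v))).
      * apply in_prod; [apply in_seq; lia|].
        apply in_prod; apply is_word_in_words; apply HE.
      * exists x; split; [|assumption]; unfold badic, cell in *; lra.
  - apply pos_INR.
  - intros x u Hx Hu; destruct (excluded_middle_informative True); rewrite Rmult_1_r, Rmult_1_l.
    all: destruct (Hcell x Hx) as (k & Hk & Hc).
    all: eapply Rle_trans;
      [apply (list_sum_indicator_le _ _ (EJ b gamma psi q (badic b p k) u))|].
    1, 3: intros v (k' & _ & Hc' & HE); now rewrite (Huniq x k k' Hc Hc').
    all: apply le_INR, Nat.le_trans with (eJ b gamma psi q (badic b p k)).
    all: apply in_le_list_max.
    1, 3: apply in_map_iff; exists u; split; [reflexivity | now apply is_word_in_words].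
    all: apply in_map_iff; exists k; split; [reflexivity | apply in_seq; lia].
Qed.

(** Integers at distance less than 1 are equal, so the limit is attained at some level. *)
Lemma e_is_level (b : nat) (gamma : R) (psi : R -> R) (q n : nat) :
  e_is b gamma psi q n -> exists p, e_level b gamma psi q p = n.
Proof.
  intros H; destruct (H 1 ltac:(lra)) as [p Hp]; exists p.
  specialize (Hp p ltac:(lia)); unfold Rdist in Hp; apply Rabs_def2 in Hp.
  assert (e_level b gamma psi q p < S n)%nat by (apply INR_lt; rewrite S_INR; lra).
  assert (n < S (e_level b gamma psi q p))%nat by (apply INR_lt; rewrite S_INR; lra).
  lia.
Qed.

(** * The series [S] and its derivative *)

Lemma ex_series_geom_bound (a : nat -> R) (C q : R) :
  0 <= q < 1 -> (forall n, Rabs (a n) <= C * q ^ n) -> ex_series a.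
Proof.
  intros Hq Ha;
    apply (ex_series_le (K := R_AbsRing) (V := R_CompleteNormedModule) a (fun n => C * q ^ n));
    [exact Ha|].
  apply (ex_series_scal_l (K := R_AbsRing) (V := R_NormedModule)).
  exists (/ (1 - q)); apply is_series_geom; rewrite Rabs_right; lra.
Qed.

Lemma Series_geom_bound (a : nat -> R) (C q : R) :
  0 <= q < 1 -> (forall n, Rabs (a n) <= C * q ^ n) -> Rabs (Series a) <= C / (1 - q).
Proof.
  intros Hq Ha.
  assert (Hqn : forall n, 0 <= q ^ n) by (intro; apply pow_le; lra).
  assert (HC : forall n, Rabs (C * q ^ n) <= C * q ^ n).
  { intro n; rewrite Rabs_right; [lra|]; generalize (Ha n) (Rabs_pos (a n)); lra. }
  assert (Habs : ex_series (fun n => Rabs (a n))).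
  { apply ex_series_geom_bound with C q; [assumption|].
    intro n; now rewrite Rabs_Rabsolu. }
  eapply Rle_trans; [now apply Series_Rabs|].
  eapply Rle_trans.
  - apply Series_le with (b := fun n => C * q ^ n); [|now apply ex_series_geom_bound with C q].
    intro n; split; [apply Rabs_pos | apply Ha].
  - rewrite Series_scal_l, Series_geom by (rewrite Rabs_right; lra).
    unfold Rdiv; lra.
Qed.

Lemma Series_two_terms (a : nat -> R) (q : R) :
  0 <= q < 1 -> (forall n, Rabs (a n) <= q ^ n) ->
  exists rho, Rabs rho <= q ^ 2 / (1 - q) /\ Series a = a 0%nat + a 1%nat + rho.
Proof.
  intros Hq Ha; exists (Series (fun n => a (S (S n)))); split.
  - apply Series_geom_bound; [assumption|].
    intro n; rewrite <- pow_add; apply Ha.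
  - assert (Hex : ex_series a).
    { apply ex_series_geom_bound with 1 q; [assumption|]; intro n; rewrite Rmult_1_l; apply Ha. }
    rewrite Series_incr_1 by assumption; rewrite Series_incr_1; [lra|].
    now apply ex_series_incr_1 in Hex.
Qed.

Lemma series_val_Series (a : nat -> R) : ex_series a -> series_val a = Series a.
Proof.
  intros Ha; apply Series_correct, is_series_Reals in Ha.
  apply uniqueness_sum with a; [|assumption].
  unfold series_val; apply epsilon_spec; now exists (Series a).
Qed.

(** Termwise differentiation: the quadratic remainders sum geometrically to at most [K * h ^ 2],
    which is negligible after division by [h]. *)
Lemma derivable_pt_lim_Series (f : nat -> R -> R) (g : nat -> R) (x C q : R) :
  0 <= q < 1 ->
  (forall y, ex_series (fun n => f n y)) -> ex_series g ->
  (forall n h, Rabs (f n (x + h) - f n x - h * g n) <= C * h ^ 2 * q ^ n) ->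
  derivable_pt_lim (fun y => Series (fun n => f n y)) x (Series g).
Proof.
  intros Hq Hf Hg Hfg eps Heps.
  set (K := C / (1 - q)).
  assert (HK : forall h, Rabs (Series (fun n => f n (x + h)) - Series (fun n => f n x)
                               - h * Series g) <= K * h ^ 2).
  { intro h; rewrite <- Series_scal_l, <- !Series_minus.
    - replace (K * h ^ 2) with (C * h ^ 2 / (1 - q)) by (unfold K; field; lra).
      now apply Series_geom_bound.
    - apply (ex_series_minus (K := R_AbsRing) (V := R_NormedModule)); apply Hf.
    - now apply (ex_series_scal_l (K := R_AbsRing) (V := R_NormedModule)).
    - apply Hf.
    - apply Hf. }
  assert (HK0 : 0 <= K).
  { generalize (HK 1) (Rabs_pos (Series (fun n => f n (x + 1)) -
      Series (fun n => f n x) - 1 * Series g)); lra. }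
  (* [K + 1] rather than [K], since [K] may be 0. *)
  assert (Hd : 0 < eps / (K + 1)) by (apply Rdiv_lt_0_compat; lra).
  exists (mkposreal _ Hd); simpl; intros h Hh Hhd.
  apply Rlt_div_r in Hhd; [|lra].
  assert (Hpos : 0 < Rabs h) by now apply Rabs_pos_lt.
  replace (_ / h - Series g) with
    ((Series (fun n => f n (x + h)) - Series (fun n => f n x) - h * Series g) / h)
    by (field; assumption).
  rewrite Rabs_div by assumption; apply Rlt_div_l; [assumption|].
  specialize (HK h); rewrite <- pow2_abs in HK; nra.
Qed.

(** The mean value theorem turns the remainder into [t * (cos c - cos a)], and the cosine is
    1-Lipschitz. The constant 1 in place of 1/2 is enough. *)
Lemma sin_taylor1 (a t : R) : Rabs (sin (a + t) - sin a - t * cos a) <= t ^ 2.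
Proof.
  assert (Hcos : forall u v, Rabs (cos v - cos u) <= Rabs (v - u)).
  { intros u v; destruct (MVT_abs cos (fun y => - sin y) u v) as (c & -> & _).
    - intros; apply derivable_pt_lim_cos.
    - rewrite Rabs_Ropp; assert (Rabs (sin c) <= 1) by apply Rabs_le, SIN_bound.
      generalize (Rabs_pos (v - u)); nra. }
  destruct (MVT_gen sin a (a + t) cos) as (c & Hc & Heq).
  - intros; apply is_derive_Reals, derivable_pt_lim_sin.
  - intros; apply continuity_sin.
  - rewrite Heq; replace (cos c * (a + t - a) - t * cos a)
      with (t * (cos c - cos a)) by ring.
    rewrite Rabs_mult, <- pow2_abs; simpl; rewrite Rmult_1_r.
    apply Rmult_le_compat_l; [apply Rabs_pos|].
    eapply Rle_trans; [apply Hcos|].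
    unfold Rmin, Rmax in Hc; destruct (Rle_dec a (a + t));
      unfold Rabs; destruct (Rcase_abs (c - a)), (Rcase_abs t); lra.
Qed.

Definition phase (b : nat) (x : R) (i : nat -> nat) (n : nat) : R :=
  2 * PI * ((x + sum_f_R0 (fun m => INR (i m) * INR b ^ m) n) / INR b ^ (S n)).

Lemma Rabs_sin_le1 (x : R) : Rabs (sin x) <= 1.
Proof. apply Rabs_le, SIN_bound. Qed.

Lemma Rabs_cos_le1 (x : R) : Rabs (cos x) <= 1.
Proof. apply Rabs_le, COS_bound. Qed.

Lemma Rabs_pow_mult_le (q y : R) (n : nat) :
  0 <= q -> Rabs y <= 1 -> Rabs (q ^ n * y) <= q ^ n.
Proof.
  intros Hq Hy; assert (Hqn : 0 <= q ^ n) by now apply pow_le.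
  rewrite Rabs_mult, (Rabs_right (q ^ n)) by lra.
  rewrite <- (Rmult_1_r (q ^ n)) at 2; now apply Rmult_le_compat_l.
Qed.

Lemma ex_series_weighted (a : nat -> R) (q : R) :
  0 <= q < 1 -> (forall n, Rabs (a n) <= 1) -> ex_series (fun n => q ^ n * a n).
Proof.
  intros Hq Ha; apply ex_series_geom_bound with 1 q; [assumption|].
  intro n; rewrite Rmult_1_l; apply Rabs_pow_mult_le; [lra | apply Ha].
Qed.

Lemma Sfun_Series (b : nat) (gamma x : R) (i : nat -> nat) :
  0 <= gamma < 1 ->
  Sfun b gamma psi0 x i = - (2 * PI) * Series (fun n => gamma ^ n * sin (phase b x i n)).
Proof.
  intros Hg; rewrite <- Series_scal_l; unfold Sfun.
  replace (fun n => gamma ^ n * psi0 _)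
    with (fun n => - (2 * PI) * (gamma ^ n * sin (phase b x i n))).
  - apply series_val_Series, (ex_series_scal_l (K := R_AbsRing) (V := R_NormedModule)).
    apply ex_series_weighted; [assumption | intro; apply Rabs_sin_le1].
  - apply functional_extensionality; intro n; unfold psi0, phase; ring.
Qed.

(** The phase of index [n] has slope [2 * PI / b ^ (n + 1)] in [x], whence the ratio [gamma / b] and
    one more factor [2 * PI / b] in front. *)
Lemma Sder_Series (b : nat) (gamma x : R) (i : nat -> nat) :
  (1 <= b)%nat -> 0 <= gamma < 1 ->
  Sder b gamma psi0 x i =
    - (4 * PI ^ 2 / INR b) * Series (fun n => (gamma / INR b) ^ n * cos (phase b x i n)).
Proof.
  intros Hb Hg; assert (Hb1 : 1 <= INR b) by (apply (le_INR 1); assumption).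
  set (g := fun n => gamma ^ n * (2 * PI / INR b ^ S n * cos (phase b x i n))).
  assert (Hbn : forall n, 1 <= INR b ^ n) by (intro; now apply pow_R1_Rle).
  assert (Hpi := PI_RGT_0).
  assert (Hg' : g = fun n => 2 * PI / INR b * ((gamma / INR b) ^ n * cos (phase b x i n))).
  { apply functional_extensionality; intro n; unfold g.
    unfold Rdiv; rewrite Rpow_mult_distr, pow_inv; simpl; specialize (Hbn n).
    field; lra. }
  assert (Hq : 0 <= gamma / INR b < 1).
  { split; [apply Rle_mult_inv_pos; lra | apply Rlt_div_l; lra]. }
  assert (Hlim : derivable_pt_lim (fun y => Sfun b gamma psi0 y i) x (- (2 * PI) * Series g)).
  { replace (fun y => Sfun b gamma psi0 y i) with
      (mult_real_fct (- (2 * PI)) (fun y => Series (fun n => gamma ^ n * sin (phase b y i n)))).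
    - apply derivable_pt_lim_scal.
      apply (derivable_pt_lim_Series (fun n y => gamma ^ n * sin (phase b y i n)) g x
        ((2 * PI) ^ 2) gamma); [assumption | | |].
      + intro y; apply ex_series_weighted; [assumption | intro; apply Rabs_sin_le1].
      + rewrite Hg'; apply (ex_series_scal_l (K := R_AbsRing) (V := R_NormedModule)).
        apply ex_series_weighted; [assumption | intro; apply Rabs_cos_le1].
      + intros n h; unfold g.
        (* The increment of the phase, at most [2 * PI] times [h] in modulus; hence the constant
           [(2 * PI) ^ 2]. *)
        set (t := 2 * PI / INR b ^ S n * h).
        replace (phase b (x + h) i n) with (phase b x i n + t)
          by (unfold phase, t; specialize (Hbn (S n)); field; lra).
        replace (_ - _) with (gamma ^ n * (sin (phase b x i n + t) - sin (phase b x i n)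
          - t * cos (phase b x i n))) by (unfold t; ring).
        assert (Hgn : 0 <= gamma ^ n) by (apply pow_le; lra).
        rewrite Rabs_mult, (Rabs_right (gamma ^ n)), Rmult_comm by lra.
        apply Rmult_le_compat_r; [assumption|].
        eapply Rle_trans; [apply sin_taylor1|].
        unfold t; rewrite Rpow_mult_distr; apply Rmult_le_compat_r; [apply pow2_ge_0|].
        apply pow_incr; specialize (Hbn (S n)); split.
        * apply Rle_mult_inv_pos; lra.
        * apply Rle_div_l; nra.
    - apply functional_extensionality; intro y; unfold mult_real_fct.
      now rewrite Sfun_Series. }
  transitivity (- (2 * PI) * Series g).
  - apply uniqueness_limite with (fun y => Sfun b gamma psi0 y i) x; [|assumption].
    unfold Sder; apply epsilon_spec; eexists; exact Hlim.
  - rewrite Hg', Series_scal_l; field; lra.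
Qed.

(** * Trigonometry of tangent pairs *)

(** Half the difference of two tails obeys the bound of a single tail. Dividing by the coefficients
    [2 * PI] and [4 * PI ^ 2 / 5], both above 2, does not enlarge the tolerances. *)
Lemma tangent_two_terms (gamma eps delta x : R) (i j : nat -> nat) :
  0 <= gamma < 1 -> tangent 5 gamma psi0 eps delta x i j ->
  let dsin n := (sin (phase 5 x i n) - sin (phase 5 x j n)) / 2 in
  let dcos n := (cos (phase 5 x i n) - cos (phase 5 x j n)) / 2 in
  Rabs (dsin 0%nat + gamma * dsin 1%nat) <= gamma ^ 2 / (1 - gamma) + eps /\
  Rabs (dcos 0%nat + gamma / 5 * dcos 1%nat)
    <= (gamma / 5) ^ 2 / (1 - gamma / 5) + delta.
Proof.
  intros Hg [Hs Hc]; cbv zeta.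
  assert (Hpi : 3 < PI) by (generalize PI2_3_2; lra).
  assert (Hcoef : forall k D d, 2 <= k -> Rabs (k * D) <= d -> Rabs D <= d / 2).
  { intros k D d Hk H; rewrite Rabs_mult, Rabs_right in H by lra.
    generalize (Rabs_pos D); nra. }
  split.
  - rewrite !Sfun_Series in Hs by assumption.
    destruct (Series_two_terms (fun n => gamma ^ n * sin (phase 5 x i n)) gamma)
      as (r1 & Hr1 & E1); [assumption | intro; apply Rabs_pow_mult_le; [lra | apply Rabs_sin_le1]|].
    destruct (Series_two_terms (fun n => gamma ^ n * sin (phase 5 x j n)) gamma)
      as (r2 & Hr2 & E2); [assumption | intro; apply Rabs_pow_mult_le; [lra | apply Rabs_sin_le1]|].
    rewrite <- Rmult_minus_distr_l, Ropp_mult_distr_l_reverse, Rabs_Ropp in Hs.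
    apply Hcoef in Hs; [|lra]; rewrite E1, E2 in Hs; simpl (_ ^ 0) in Hs; simpl (_ ^ 1) in Hs.
    apply Rabs_le_between in Hs, Hr1, Hr2; apply Rabs_le_between; lra.
  - rewrite !Sder_Series in Hc by (assumption || lia).
    replace (INR 5) with 5 in Hc by (simpl; lra).
    set (q := gamma / 5) in *; assert (Hq : 0 <= q < 1) by (unfold q; lra).
    destruct (Series_two_terms (fun n => q ^ n * cos (phase 5 x i n)) q)
      as (r1 & Hr1 & E1); [assumption | intro; apply Rabs_pow_mult_le; [lra | apply Rabs_cos_le1]|].
    destruct (Series_two_terms (fun n => q ^ n * cos (phase 5 x j n)) q)
      as (r2 & Hr2 & E2); [assumption | intro; apply Rabs_pow_mult_le; [lra | apply Rabs_cos_le1]|].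
    rewrite <- Rmult_minus_distr_l, Ropp_mult_distr_l_reverse, Rabs_Ropp in Hc.
    apply Hcoef in Hc; [|simpl; nra]; rewrite E1, E2 in Hc; simpl (_ ^ 0) in Hc; simpl (_ ^ 1) in Hc.
    apply Rabs_le_between in Hc, Hr1, Hr2; apply Rabs_le_between; lra.
Qed.

Lemma sin2_PI5_bounds :
  345 / 1000 <= sin (PI / 5) ^ 2 /\ 9 / 10 <= sin (2 * (PI / 5)) ^ 2.
Proof.
  assert (Hpi := PI_RGT_0); set (t := PI / 5).
  assert (Hs : 0 < sin t) by (apply sin_gt_0; unfold t; lra).
  assert (Hc : 0 < cos t) by (apply cos_gt_0; unfold t; lra).
  assert (Hsc : sin t * sin t + cos t * cos t = 1) by apply sin2_cos2.
  (* As [3 * t = PI - 2 * t], the cosine of [t] is the positive root of a quadratic, (1 + sqrt 5) /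
     4, about 0.80902. *)
  assert (H : sin (2 * t + t) = sin (2 * t)).
  { replace (2 * t + t) with (PI - 2 * t) by (unfold t; field); apply sin_PI_x. }
  rewrite sin_plus, sin_2a, cos_2a_cos in H.
  assert (Hq : 4 * (cos t * cos t) - 2 * cos t - 1 = 0).
  { apply Rmult_eq_reg_l with (sin t); [|lra]; nra. }
  assert (Hc1 : 809 / 1000 <= cos t) by (apply Rnot_lt_le; intro; nra).
  assert (Hc2 : cos t <= 8092 / 10000) by (apply Rnot_lt_le; intro; nra).
  assert (Hs2 : 345 / 1000 <= sin t * sin t) by nra.
  assert (Hcc : 654 / 1000 <= cos t * cos t) by nra.
  rewrite sin_2a; split; [lra|].
  replace ((2 * sin t * cos t) ^ 2) with (4 * ((sin t * sin t) * (cos t * cos t))) by ring.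
  nra.
Qed.

(** Half the chord of the unit circle between the angles [A] and [B]. *)
Lemma chord_sqr (A B : R) :
  ((sin A - sin B) / 2) ^ 2 + ((cos A - cos B) / 2) ^ 2 = sin ((A - B) / 2) ^ 2.
Proof.
  rewrite form4, form2.
  generalize (sin2_cos2 ((A + B) / 2)); unfold Rsqr; intro H.
  replace (sin ((A - B) / 2) ^ 2) with (sin ((A - B) / 2) ^ 2 * 1) by ring.
  rewrite <- H; field.
Qed.

Lemma geom_tail_le (g g0 : R) :
  0 < g <= g0 -> g0 < 1 -> g ^ 2 / (1 - g) <= g0 ^ 2 / (1 - g0).
Proof.
  intros Hg Hg0; apply Rmult_le_compat.
  - apply pow2_ge_0.
  - left; apply Rinv_0_lt_compat; lra.
  - apply pow_incr; lra.
  - apply Rinv_le_contravar; lra.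
Qed.

Lemma Rabs_le_of_sum (U g v d g0 d0 : R) :
  0 <= g <= g0 -> d <= d0 -> Rabs (U + g * v) <= d -> Rabs U <= g0 * Rabs v + d0.
Proof.
  intros Hg Hd H; replace U with ((U + g * v) - g * v) by ring.
  eapply Rle_trans; [apply Rabs_triang|].
  rewrite Rabs_Ropp, Rabs_mult, (Rabs_right g) by lra.
  assert (g * Rabs v <= g0 * Rabs v) by (apply Rmult_le_compat_r; [apply Rabs_pos | lra]).
  lra.
Qed.

(* [X], [Y] are the half-differences of the leading terms of [S] and [S'];
   [s], [c] those of the next terms. *)
Lemma leading_difference_le (gamma g0 X Y s c : R) :
  0 < gamma <= g0 -> g0 < 1 ->
  Rabs (X + gamma * s) <= gamma ^ 2 / (1 - gamma) + 1 / 100000 ->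
  Rabs (Y + gamma / 5 * c) <= (gamma / 5) ^ 2 / (1 - gamma / 5) + 1 / 100000 ->
  Rabs X <= g0 * Rabs s + (g0 ^ 2 / (1 - g0) + 1 / 100000) /\
  Rabs Y <= g0 / 5 * Rabs c + ((g0 / 5) ^ 2 / (1 - g0 / 5) + 1 / 100000).
Proof.
  intros Hg Hg0 HX HY.
  generalize (geom_tail_le gamma g0) (geom_tail_le (gamma / 5) (g0 / 5)); intros T1 T2.
  split; (eapply Rabs_le_of_sum; [| | eassumption]); lra.
Qed.

(** The thresholds 9/10 and 345/1000 are the lower bounds for the squared sines of 2 PI / 5 and PI /
    5. The crude bounds on [X] and [Y] rule out the first always, and the second for
    [gamma <= 7/20]. *)
Lemma leading_difference_bounds (gamma X Y s c : R) :
  0 < gamma <= 2 / 5 ->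
  s ^ 2 + c ^ 2 <= 1 ->
  Rabs (X + gamma * s) <= gamma ^ 2 / (1 - gamma) + 1 / 100000 ->
  Rabs (Y + gamma / 5 * c) <= (gamma / 5) ^ 2 / (1 - gamma / 5) + 1 / 100000 ->
  X ^ 2 + Y ^ 2 < 9 / 10 /\
  (345 / 1000 <= X ^ 2 + Y ^ 2 -> 7 / 20 < gamma /\ Y ^ 2 <= (57 / 1000) ^ 2).
Proof.
  intros Hg Hsc HX HY.
  rewrite <- (pow2_abs X), <- (pow2_abs Y); rewrite <- (pow2_abs s), <- (pow2_abs c) in Hsc.
  assert (Hs : 0 <= Rabs s <= 1) by (split; [apply Rabs_pos | nra]).
  assert (Hc : 0 <= Rabs c <= 1) by (split; [apply Rabs_pos | nra]).
  assert (HX0 := Rabs_pos X); assert (HY0 := Rabs_pos Y).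
  destruct (leading_difference_le gamma (2 / 5) X Y s c) as [H1 H2]; [lra.. | | ]; try assumption.
  assert (HYc : Rabs Y <= 872 / 10000) by lra.
  assert (HXc : Rabs X <= 667 / 1000) by lra.
  split; [nra|]; intro Hlow; split.
  - apply Rnot_le_lt; intro Hsmall.
    destruct (leading_difference_le gamma (7 / 20) X Y s c) as [G1 G2]; [lra.. | | ];
      try assumption.
    assert (Rabs Y <= 754 / 10000) by lra.
    assert (Rabs X <= 539 / 1000) by lra.
    nra.
  (* Bootstrap: a small [Y] forces a large [X], hence a large [s], hence a small [c], which sharpens
     the bound on [Y] from 0.0872 to 0.057. *)
  - assert (HX2 : 5807 / 10000 <= Rabs X) by nra.
    assert (Hs2 : 785 / 1000 <= Rabs s) by lra.
    assert (Hc2 : Rabs c <= 6196 / 10000) by nra.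
    assert (Rabs Y <= 57 / 1000) by lra.
    nra.
Qed.

(** 1/10 lies just below PI / 30, the angle [2 * PI / 5 * h] at the radius [h = 1/12]. *)
Lemma sin_tenth : 998 / 10000 <= sin (1 / 10).
Proof.
  assert (Hpi : 3 < PI) by (generalize PI2_3_2; lra).
  destruct (SIN (1 / 10)) as [H _]; [lra.. |].
  eapply Rle_trans; [|exact H].
  unfold sin_lb, sin_approx, sin_term; simpl; lra.
Qed.

(** At distance [h] between 1/12 and 2 from 5/2 the angle lies between PI / 30 and 4 PI / 5, so it
    and its supplement both exceed 1/10. *)
Lemma sin2_small_near_half_period (z : R) :
  1 / 2 <= z <= 9 / 2 -> sin (2 * PI / 5 * z) ^ 2 < (998 / 10000) ^ 2 ->
  Rabs (z - 5 / 2) < 1 / 12.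
Proof.
  intros Hz Hsin; apply Rnot_le_lt; intro Hfar.
  assert (Hpi : 3 < PI) by (generalize PI2_3_2; lra).
  assert (Hlow : forall h, 1 / 12 <= h <= 2 -> 998 / 10000 <= sin (2 * PI / 5 * h)).
  { intros h Hh; eapply Rle_trans; [apply sin_tenth|].
    destruct (Rle_dec (2 * PI / 5 * h) (PI / 2)).
    - apply sin_incr_1; nra.
    - rewrite <- (sin_PI_x (2 * PI / 5 * h)); apply sin_incr_1; nra. }
  assert (Hshift : forall h, sin (2 * PI / 5 * (5 / 2 + h)) = - sin (2 * PI / 5 * h)).
  { intro h; rewrite <- neg_sin; f_equal; field. }
  replace z with (5 / 2 + (z - 5 / 2)) in Hsin by ring; rewrite Hshift in Hsin.
  unfold Rabs in Hfar; destruct (Rcase_abs (z - 5 / 2)).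
  - specialize (Hlow (- (z - 5 / 2)) ltac:(lra)).
    rewrite <- Ropp_mult_distr_r, sin_neg in Hlow; nra.
  - specialize (Hlow (z - 5 / 2) ltac:(lra)); nra.
Qed.

(* For [k <> l]: the midpoint [x + (k + l) / 2] is within 1/12 of 5/2, the only
   zero of [sin (2 PI z / 5)] in its range. *)
Definition near_tangent (x : R) (k l : nat) : Prop :=
  match k, l with
  | 1, 2 | 2, 1 => (11 / 12 <= x < 1)%R
  | 2, 3 | 3, 2 => (0 <= x < 1 / 12)%R
  | 0, 4 | 4, 0 => (5 / 12 <= x < 7 / 12)%R
  | _, _ => k = l
  end%nat.

Lemma near_tangent_sym (x : R) (k l : nat) : near_tangent x k l -> near_tangent x l k.
Proof.
  unfold near_tangent.
  destruct k as [|[|[|[|[|k]]]]], l as [|[|[|[|[|l]]]]]; auto.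
Qed.

(** With [w] the sine of (l - k) PI / 5 and [z] the midpoint, the leading half-differences satisfy
    [X ^ 2 + Y ^ 2 = w ^ 2] and [Y ^ 2 = w ^ 2 * sin (2 * PI / 5 * z) ^ 2]. Digits differing by 2 or
    3 make [w] too large; for the others [z] must be near 5/2. *)
Lemma Eloc_near_tangent_lt (gamma x : R) (k l : nat) :
  0 < gamma <= 2 / 5 -> in01 x -> (k < l < 5)%nat ->
  Eloc 5 gamma psi0 1 x (1 / 100000) (1 / 100000) [k] [l] ->
  7 / 20 < gamma /\ near_tangent x k l.
Proof.
  intros Hg [Hx0 Hx1] Hkl (_ & _ & u & v & _ & _ & Ht).
  apply tangent_two_terms in Ht; [|lra]; cbv zeta in Ht; destruct Ht as [HX HY].
  set (A := phase 5 x (concat_seq [k] u) 0) in *; set (B := phase 5 x (concat_seq [l] v) 0) in *.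
  assert (Hphase : forall d w, phase 5 x (concat_seq [d] w) 0 = 2 * PI / 5 * (x + INR d)).
  { intros d w; unfold phase, concat_seq; simpl; field. }
  assert (Hchord : forall a b, ((sin a - sin b) / 2) ^ 2 + ((cos a - cos b) / 2) ^ 2 <= 1).
  { intros a b; rewrite chord_sqr; generalize (SIN_bound ((a - b) / 2)); nra. }
  generalize (leading_difference_bounds _ _ _ _ _ Hg (Hchord _ _) HX HY); clear HX HY; intro HX.
  rewrite chord_sqr, form2 in HX.
  destruct sin2_PI5_bounds as [S1 S2].
  replace ((A + B) / 2) with (2 * PI / 5 * (x + (INR k + INR l) / 2)) in HX
    by (unfold A, B; rewrite !Hphase; field).
  replace ((A - B) / 2) with (- ((INR l - INR k) * (PI / 5))) in HX
    by (unfold A, B; rewrite !Hphase; field).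
  rewrite sin_neg in HX.
  set (w := sin ((INR l - INR k) * (PI / 5))) in HX.
  replace ((- w) ^ 2) with (w ^ 2) in HX by ring.
  set (z := x + (INR k + INR l) / 2) in *.
  replace ((-2 * - w * sin (2 * PI / 5 * z) / 2) ^ 2)
    with (w ^ 2 * sin (2 * PI / 5 * z) ^ 2) in HX by field.
  destruct HX as [Hw HX].
  assert (Hw2 : 345 / 1000 <= w ^ 2 /\ ((l - k = 2 \/ l - k = 3)%nat -> 9 / 10 <= w ^ 2)).
  { unfold w; rewrite <- minus_INR by lia.
    assert (Hm : (l - k = 1 \/ l - k = 2 \/ l - k = 3 \/ l - k = 4)%nat) by lia.
    destruct Hm as [-> | [-> | [-> | ->]]]; simpl INR.
    - replace (1 * (PI / 5)) with (PI / 5) by ring; split; [assumption | lia].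
    - replace (1 + 1) with 2 by ring; split; [lra | intros; assumption].
    - rewrite <- sin_PI_x; replace (PI - _) with (2 * (PI / 5)) by field.
      split; [lra | intros; assumption].
    - rewrite <- sin_PI_x; replace (PI - _) with (PI / 5) by field.
      split; [assumption | lia]. }
  destruct Hw2 as [Hw1 Hw2]; destruct (HX Hw1) as [Hg' Hsmall]; split; [assumption|].
  assert (Hkl' : (k = 0 /\ l = 1 \/ k = 1 /\ l = 2 \/ k = 2 /\ l = 3 \/ k = 3 /\ l = 4
     \/ k = 0 /\ l = 4 \/ l - k = 2 \/ l - k = 3)%nat) by lia.
  (* (57/1000)^2 divided by 345/1000 is about 0.00942, below (998/10000)^2. *)
  assert (Hnear : 1 / 2 <= z <= 9 / 2 -> Rabs (z - 5 / 2) < 1 / 12).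
  { intro Hz; apply sin2_small_near_half_period; [assumption|].
    generalize (pow2_ge_0 (sin (2 * PI / 5 * z))); nra. }
  (* For (0,1) and (3,4) the midpoint stays at least 1 away from 5/2, a contradiction; the other
     three pairs give the intervals of [near_tangent]. *)
  destruct Hkl' as [[-> ->] | [[-> ->] | [[-> ->] | [[-> ->] | [[-> ->] | H]]]]];
    [.. | specialize (Hw2 H); lra].
  all: unfold z in Hnear; simpl INR in Hnear; specialize (Hnear ltac:(lra)).
  all: apply Rabs_def2 in Hnear; unfold near_tangent; lra.
Qed.

Lemma Eloc_near_tangent (gamma x : R) (u v : list nat) :
  0 < gamma <= 2 / 5 -> in01 x ->
  Eloc 5 gamma psi0 1 x (1 / 100000) (1 / 100000) u v ->
  exists k l, u = [k] /\ v = [l] /\ (k = l \/ 7 / 20 < gamma /\ near_tangent x k l).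
Proof.
  intros Hg Hx HE; assert (HE' := HE); destruct HE' as ([Hu Fu] & [Hv Fv] & _).
  destruct u as [|k [|? ?]]; try discriminate; destruct v as [|l [|? ?]]; try discriminate.
  inversion_clear Fu; inversion_clear Fv.
  exists k, l; repeat split; destruct (Nat.lt_trichotomy k l) as [Hlt | [-> | Hlt]];
    [right | now left | right].
  - apply Eloc_near_tangent_lt; auto.
  - apply Eloc_sym, Eloc_near_tangent_lt in HE; auto.
    split; [apply HE | now apply near_tangent_sym].
Qed.

(** * The three ranges of [gamma] *)

Lemma words_5_1 : words 5 1 = [[0]; [1]; [2]; [3]; [4]]%nat.
Proof. reflexivity. Qed.

(** Only equal words are tangent, so with a constant weight every row sum is 1. *)
Lemma sigma_q_le_1 (gamma : R) :
  0 < gamma <= 7 / 20 -> sigma_q 5 gamma psi0 1 <= 1.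
Proof.
  intros Hg.
  apply sigma_q_le_of_relation with
    (omega := fun x => if excluded_middle_informative True then 1 else 1)
    (Q := fun _ u v => u = v).
  - apply weight_two_valued; [lra | lra | apply lebesgue_measurable_const].
  - intros u v; apply lebesgue_measurable_const.
  - exists (1 / 100000), (1 / 100000); split; [lra | split; [lra|]].
    intros x u v Hx HE; apply Eloc_near_tangent in HE; [|lra | assumption].
    destruct HE as (k & l & -> & -> & [-> | [H _]]); [reflexivity | lra].
  - lra.
  - intros x u _ Hu; apply is_word_in_words in Hu; rewrite words_5_1 in *.
    destruct (excluded_middle_informative True); rewrite Rmult_1_l, Rmult_1_r.
    all: unfold indicator; simpl.
    all: repeat destruct Hu as [<- | Hu]; try destruct Hu.
    all: repeat match goal with
      |- context [excluded_middle_informative ?P] =>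
        destruct (excluded_middle_informative P); try congruence end; lra.
Qed.

(** A digit has at most one other tangent digit, and only for [x] in [B]. There the weight is 1 and
    the images of [x] under the two tangent digits lie outside [B], so the requirement is 2 <=
    (3/2)(3/2). A row sum 1 needs only that the weights have ratio at most 3/2. The radius 1/12 is
    the largest for which these images avoid [B]: some of them share an endpoint with it. *)
Lemma sigma_q_le_3_2 (gamma : R) :
  0 < gamma <= 2 / 5 -> sigma_q 5 gamma psi0 1 <= 3 / 2.
Proof.
  intros Hg.
  set (B := fun x => 0 <= x < 1 / 12 \/ 5 / 12 <= x < 7 / 12 \/ 11 / 12 <= x < 1).
  apply sigma_q_le_of_relation with
    (omega := fun x => if excluded_middle_informative (B x) then 1 else 3 / 2)
    (Q := fun x u v => near_tangent x (hd O u) (hd O v)).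
  - apply weight_two_valued; [lra | lra |].
    repeat apply lebesgue_measurable_union; apply lebesgue_measurable_Ico.
  - intros u v; unfold near_tangent.
    destruct (hd O u) as [|[|[|[|[|k]]]]], (hd O v) as [|[|[|[|[|l]]]]];
      apply lebesgue_measurable_const || apply lebesgue_measurable_Ico.
  - exists (1 / 100000), (1 / 100000); split; [lra | split; [lra|]].
    intros x u v Hx HE; apply Eloc_near_tangent in HE; [|lra | assumption].
    destruct HE as (k & l & -> & -> & [-> | [_ H]]); [|exact H].
    now destruct l as [|[|[|[|[|l]]]]].
  - lra.
  - intros x u [Hx0 Hx1] Hu; apply is_word_in_words in Hu; rewrite words_5_1 in *.
    unfold indicator, B, xw.
    repeat destruct Hu as [<- | Hu]; try destruct Hu; simpl.
    all: repeat match goal with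
      |- context [excluded_middle_informative ?P] =>
        destruct (excluded_middle_informative P);
          try (exfalso; lra); try discriminate; try tauto end; lra.
Qed.

Theorem theorem4p2 (gamma : R) :
  1 / 5 < gamma < 1 ->
  e_is 5%nat gamma psi0 1%nat 2%nat ->
  sigma_q 5%nat gamma psi0 1%nat < 5 * gamma.
Proof.
  intros Hg He.
  destruct (Rle_dec gamma (7 / 20)).
  { generalize (sigma_q_le_1 gamma); lra. }
  (* Here [5 * gamma] exceeds 7/4, hence 3/2. *)
  destruct (Rle_dec gamma (2 / 5)).
  { generalize (sigma_q_le_3_2 gamma); lra. }
  destruct (e_is_level _ _ _ _ _ He) as [p Hp].
  generalize (sigma_q_le_e_level 5 gamma psi0 1 p ltac:(lia)); rewrite Hp; simpl; lra.
Qed.
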